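(* Let $n\ge 2$ be an integer with prime factorization $n=p_{\tau-1}\cdots p_1p_0$ (the $p_r$ prime, not necessarily distinct, in some fixed order), and let $\{W^{(l)}\}_{l\in\mathbb N}\subset\mathbb R^{n\times n}$ be the weight matrices of the associated $p$-peer hyper-cuboids. Then each matrix $W^{(l)}$ is symmetric and doubly stochastic. Moreover, for any index sequence $\{l_i\}_{i=0}^{\tau-1}\subset\mathbb N$ with $\{\mathrm{mod}(l_0,\tau),\dots,\mathrm{mod}(l_{\tau-1},\tau)\}=\{0,\dots,\tau-1\}$, the matrices $\{W^{(l_i)}\}_{i=0}^{\tau-1}$ have the finite-time consensus property with parameter $\tau$.
   Context: $\mathbb N=\{0,1,2,\dots\}$; $\mathrm{mod}(a,m)\in\{0,\dots,m-1\}$ is the remainder of $a$ modulo $m$; $\mathbf 1\in\mathbb R^n$ is the all-ones vector; rows and columns of $n\times n$ matrices are indexed by $0,1,\dots,n-1$. Multi-base representation: given $n=p_{\tau-1}\cdots p_1p_0$, every integer $i\in\{0,\dots,n-1\}$ has a unique representation by digits $(i_{\tau-1},\dots,i_1,i_0)$ with $i_r\in\{0,\dots,p_r-1\}$, namely $i=\sum_{r=0}^{\tau-1} i_r\prod_{s<r}p_s$ (e.g. for $(p_1,p_0)=(2,3)$: $4\mapsto(1,1)$, $5\mapsto(1,2)$). $p$-peer hyper-cuboids: $W^{(l)}=[w^{(l)}_{ij}]_{i,j=0}^{n-1}$ where, with $r=\mathrm{mod}(l,\tau)$, $w^{(l)}_{ij}=\frac{1}{p_r}$ if the multi-base representations of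 $i$ and $j$ differ in the $r$-th digit and agree in all other digits; $w^{(l)}_{ij}=\frac1{p_r}$ if $i=j$; and $w^{(l)}_{ij}=0$ otherwise. Finite-time consensus property: a finite sequence of matrices $\{A^{(i)}\}_{i=0}^{\tau-1}\subset\mathbb R^{n\times n}$ (weight matrices of graphs on $n$ nodes), $\tau\ge1$, has the finite-time consensus property with parameter $\tau$ if and only if every $A^{(i)}$ is doubly stochastic and $A^{(\tau-1)}A^{(\tau-2)}\cdots A^{(1)}A^{(0)}=\frac1n\mathbf 1\mathbf 1^{\mathsf T}$. *)

(* Defs.v *)
From HB Require Import structures.
From mathcomp Require Import all_boot all_order all_algebra.
From mathcomp Require Import reals.

Set Implicit Arguments.
Unset Strict Implicit.
Unset Printing Implicit Defensive.

Import Order.TTheory GRing.Theory Num.Theory.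

(* Only the values [p r] with [r < tau] of a base sequence [p : nat -> nat]
   matter in what follows. *)

Definition place (p : nat -> nat) (r : nat) : nat := (\prod_(s < r) p s)%N.

(* [digit p i r] is the digit i_r of i in the bases p_{tau-1}, ..., p_0 ;
   [sum_digit] and [digit_unique] show that these are the digits of the one
   representation i = \sum_(r < tau) i_r * \prod_(s < r) p_s with i_r < p_r. *)
Definition digit (p : nat -> nat) (i r : nat) : nat :=
  ((i %/ place p r) %% p r)%N.

Lemma placeS p r : place p r.+1 = (place p r * p r)%N.
Proof. by rewrite /place big_ord_recr. Qed.

Lemma place_gt0 p r : (forall s, (s < r)%N -> (0 < p s)%N) -> (0 < place p r)%N.
Proof. by move=> p_gt0; apply: prodn_cond_gt0 => s _; apply: p_gt0. Qed.

Lemma digit_lt p i r : (0 < p r)%N -> (digit p i r < p r)%N.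
Proof. exact: ltn_pmod. Qed.

Lemma sum_digit_mod p tau i : (forall r, (r < tau)%N -> (0 < p r)%N) ->
  (\sum_(r < tau) digit p i r * place p r = i %% place p tau)%N.
Proof.
elim: tau => [|t IHt] p_gt0; first by rewrite /place !big_ord0 modn1.
have p_gt0' r : (r < t)%N -> (0 < p r)%N by move=> ?; apply/p_gt0/ltnW.
have w_gt0 := place_gt0 p_gt0'.
rewrite big_ord_recr /= IHt // placeS /digit.
set w := place p t in w_gt0 *.
have lt_d : (i %/ w %% p t < p t)%N by rewrite ltn_pmod ?p_gt0.
have lt_dw : (i %/ w %% p t * w + i %% w < w * p t)%N.
  apply: (@leq_trans ((i %/ w %% p t).+1 * w)%N).
    by rewrite mulSn addnC ltn_add2r ltn_pmod.
  by rewrite (mulnC w) leq_mul2r lt_d orbT.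
rewrite {3}(divn_eq i w) {2}(divn_eq (i %/ w) (p t)) mulnDl -mulnA.
by rewrite (mulnC (p t)) -addnA modnMDl (modn_small lt_dw) addnC.
Qed.

Lemma sum_digit p tau i : (forall r, (r < tau)%N -> (0 < p r)%N) ->
    (i < \prod_(r < tau) p r)%N ->
  (i = \sum_(r < tau) digit p i r * \prod_(s < r) p s)%N.
Proof.
move=> p_gt0 lt_i; transitivity (i %% place p tau)%N; first by rewrite modn_small.
by rewrite -sum_digit_mod.
Qed.

Lemma digit_unique p tau (d : nat -> nat) :
    (forall r, (r < tau)%N -> (d r < p r)%N) ->
  forall r, (r < tau)%N ->
  d r = digit p (\sum_(s < tau) d s * \prod_(u < s) p u)%N r.
Proof.
move=> lt_d r lt_r.
have p_gt0 s : (s < tau)%N -> (0 < p s)%N.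
  by move=> /lt_d; apply: leq_ltn_trans.
have lt_sum t : (t <= tau)%N -> (\sum_(s < t) d s * place p s < place p t)%N.
  elim: t => [|t IHt] le_t; first by rewrite /place !big_ord0.
  rewrite big_ord_recr placeS /=.
  apply: (@leq_trans ((d t).+1 * place p t)%N).
    by rewrite mulSn ltn_add2r IHt // ltnW.
  by rewrite (mulnC (place _ _)) leq_mul2r lt_d ?orbT.
have w_gt0 : (0 < place p r)%N.
  by apply: place_gt0 => s lt_s; apply/p_gt0/(ltn_trans lt_s).
have split_sum t : (r < t <= tau)%N -> exists q,
    (\sum_(s < t) d s * place p s = (q * p r + d r) * place p r
       + \sum_(s < r) d s * place p s /\
     exists m, place p t = m * (p r * place p r))%N.
  elim: t => [|t IHt] //; rewrite ltnS => /andP[le_rt lt_t].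
  rewrite big_ord_recr placeS /=.
  move: le_rt; rewrite leq_eqVlt => /predU1P[<-|lt_rt].
    exists 0%N; split; first by rewrite mul0n add0n addnC.
    by exists 1%N; rewrite mul1n mulnC.
  have [|q [-> [m ->]]] := IHt; first by rewrite lt_rt ltnW.
  exists (q + d t * m)%N; split; last first.
    by exists (m * p t)%N; rewrite mulnAC.
  by rewrite addnAC !mulnDl !mulnA; congr (_ + _)%N; rewrite addnAC.
have [|q [eq_sum _]] := split_sum tau; first by rewrite lt_r leqnn.
rewrite /digit -[\sum_(s < tau) _]/(\sum_(s < tau) d s * place p s)%N eq_sum.
rewrite divnMDl // divn_small ?lt_sum ?(ltnW lt_r) // addn0.
by rewrite modnMDl modn_small ?lt_d.
Qed.

Local Open Scope ring_scope.

(* Weight matrices W^(l) of the p-peer hyper-cuboids on n nodes, for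
   n = p_{tau-1} ... p_0. *)
Definition hypercuboid (R : realType) (n tau : nat) (p : nat -> nat) (l : nat) :
    'M[R]_n :=
  let r := (l %% tau)%N in
  \matrix_(i < n, j < n)
    if (digit p i r != digit p j r) &&
       [forall s : 'I_tau, (val s != r) ==> (digit p i s == digit p j s)]
    then (p r)%:R^-1
    else if i == j then (p r)%:R^-1
    else 0.

Definition doubly_stochastic (R : realType) (n : nat) (A : 'M[R]_n) : Prop :=
  [/\ forall i j, 0 <= A i j,
      forall i, \sum_j A i j = 1
    & forall j, \sum_i A i j = 1].

(* [rev_ord] puts the factors in the order A^(tau-1) *m ... *m A^(0). *)
Definition finite_time_consensus (R : realType) (n tau : nat)
    (A : 'I_tau -> 'M[R]_n) : Prop :=
  [/\ (1 <= tau)%N,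
      forall i, doubly_stochastic (A i)
    & \big[mulmx/1%:M]_(i < tau) A (rev_ord i) =
      n%:R^-1 *: ((const_mx 1 : 'cV[R]_n) *m (const_mx 1 : 'cV[R]_n)^T)].

(* Main.v *)
(* For a set S of digit positions let B_S be the matrix with entry
   1 / \prod_(s in S) p_s at (i, j) when the digits of i and j agree outside S,
   and 0 elsewhere.  Then W^(l) = B_{r} with r = l mod tau, and
   B_S B_T = B_(S U T) for disjoint S and T, because exactly one k agrees with
   i outside S and with j outside T as soon as i and j agree outside S U T.
   A product running once over all the positions is therefore B_{all}, whose
   entries are all 1/n. *)
Require Import Defs.
From HB Require Import structures.
From mathcomp Require Import all_boot all_order all_algebra.
From mathcomp Require Import reals.

Set Implicit Arguments.
Unset Strict Implicit.
Unset Printing Implicit Defensive.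

Import Order.TTheory GRing.Theory Num.Theory.
Local Open Scope ring_scope.

Lemma digit_inj tau (p : nat -> nat) (i j : 'I_(\prod_(r < tau) p r)) :
    (forall r, (r < tau)%N -> (0 < p r)%N) ->
  (forall s : 'I_tau, digit p i s = digit p j s) -> i = j.
Proof.
move=> p_gt0 eq_ij; apply: val_inj => /=.
rewrite (sum_digit p_gt0 (ltn_ord i)) (sum_digit p_gt0 (ltn_ord j)).
by apply: eq_bigr => s _; rewrite eq_ij.
Qed.

Lemma digit_surj tau (p : nat -> nat) (d : 'I_tau -> nat) :
    (forall s, (d s < p s)%N) ->
  exists i : 'I_(\prod_(r < tau) p r), forall s : 'I_tau, digit p i s = d s.
Proof.
(* [digit_unique] takes digits indexed by all of [nat], so [d] is extended by the default 0 from
   position [tau] on. *)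
move=> lt_d; pose e r := if insub r is Some s then d s else 0%N.
have eE (s : 'I_tau) : e s = d s by rewrite /e valK.
have lt_e r : (r < tau)%N -> (e r < p r)%N.
  by move=> lt_r; rewrite -[r]/(val (Ordinal lt_r)) eE lt_d.
have p_gt0 r : (r < tau)%N -> (0 < p r)%N by move/lt_e; apply: leq_ltn_trans.
have digE := digit_unique lt_e.
set m := (\sum_(s < tau) _)%N in digE.
have lt_m : (m < \prod_(r < tau) p r)%N.
  (* The digits of [m] are the values of [e], so recombining them gives back [m] on one side and its
     residue on the other; hence [m] is in range. *)
  have -> : m = (m %% place p tau)%N.
    rewrite -(sum_digit_mod _ p_gt0); apply: eq_bigr => s _.
    by rewrite -digE.
  by rewrite ltn_pmod // place_gt0.
by exists (Ordinal lt_m) => s; rewrite -eE digE.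
Qed.

(** For fixed [S] this is an equivalence relation; its classes are the sub-cuboids spanned by the
    directions in [S]. *)
Definition agree_off (p : nat -> nat) tau (S : {set 'I_tau}) (i j : nat) : bool :=
  [forall s : 'I_tau, (s \notin S) ==> (digit p i s == digit p j s)].

Lemma agree_offP (p : nat -> nat) tau (S : {set 'I_tau}) i j :
  reflect (forall s, s \notin S -> digit p i s = digit p j s)
          (agree_off p S i j).
Proof.
apply: (iffP forallP) => H s; first by move=> sS; have /implyP/(_ sS)/eqP := H s.
by apply/implyP => sS; apply/eqP/H.
Qed.

Lemma agree_off_sym (p : nat -> nat) tau (S : {set 'I_tau}) i j :
  agree_off p S i j = agree_off p S j i.
Proof. by apply/agree_offP/agree_offP => H s /H ->. Qed.

Lemma agree_off0 tau (p : nat -> nat) (i j : 'I_(\prod_(r < tau) p r)) :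
    (forall r, (r < tau)%N -> (0 < p r)%N) ->
  agree_off p (set0 : {set 'I_tau}) i j = (i == j).
Proof.
move=> p_gt0; apply/agree_offP/eqP => [H|-> //].
by apply: (digit_inj p_gt0) => s; apply: H; rewrite inE.
Qed.

Lemma agree_off_setU tau (p : nat -> nat) (S T : {set 'I_tau})
    (i j : 'I_(\prod_(r < tau) p r)) :
    (forall r, (r < tau)%N -> (0 < p r)%N) -> [disjoint S & T] ->
  (\sum_(k < \prod_(r < tau) p r) agree_off p S i k * agree_off p T k j)%N =
  agree_off p (S :|: T) i j.
Proof.
move=> p_gt0 dST; case: (boolP (agree_off _ _ i j)) => [/agree_offP ij|nij].
  (* The digits of [k] are forced: off [S] they come from [i], and on [S], which lies off [T], they
     come from [j]. *)
  have [|k kE] := @digit_surj tau p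
      (fun s => if s \in S then digit p j s else digit p i s).
    by move=> s; case: ifP => _; apply/digit_lt/p_gt0.
  rewrite (bigD1 k) //= [X in (_ + X)%N]big1 ?addn0 => [|m].
    have -> : agree_off p S i k by apply/agree_offP => s /negPf sS; rewrite kE sS.
    suff -> : agree_off p T k j by [].
    apply/agree_offP => s sT; rewrite kE; case: ifP => // sS.
    by apply: ij; rewrite inE sS.
  (* A nonzero term at [m] means that [m] meets both constraints, so all its digits are those of
     [k]. *)
  apply: contraNeq; rewrite muln_eq0 !eqb0 negb_or !negbK.
  case/andP=> /agree_offP im /agree_offP mj.
  apply/eqP/(digit_inj p_gt0) => s; rewrite kE; case: ifP => sS.
    by apply: mj; rewrite (disjointFr dST).
  by rewrite im ?sS.
apply: big1 => k _; apply/eqP; rewrite muln_eq0 !eqb0 -negb_and.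
apply: contra nij => /andP[/agree_offP ik /agree_offP kj].
by apply/agree_offP => s; rewrite inE negb_or => /andP[sS sT]; rewrite ik ?kj.
Qed.

(** The class of [i] is a line in direction [r]. Setting digit [r] of [i] to [c] gives an injection
    [f] of ['I_(p r)] whose image is that line. *)
Lemma sum_agree_off1 tau (p : nat -> nat) (r : 'I_tau)
    (i : 'I_(\prod_(s < tau) p s)) :
    (forall s, (s < tau)%N -> (0 < p s)%N) ->
  (\sum_(j < \prod_(s < tau) p s) agree_off p [set r] i j)%N = p r.
Proof.
move=> p_gt0.
have ex_f (c : 'I_(p r)) : exists j : 'I_(\prod_(s < tau) p s),
    forall s : 'I_tau, digit p j s = if s == r then val c else digit p i s.
  by apply: digit_surj => s; case: eqP => [->|_]; [apply: ltn_ord|apply/digit_lt/p_gt0].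
have [f fE] := fin_all_exists ex_f.
have f_inj : injective f.
  by move=> c d eq_f; apply: val_inj; move: (fE c r); rewrite eq_f fE eqxx.
rewrite -[RHS](card_ord (p r)) -(card_codom f_inj).
rewrite -sum1_card [RHS]big_mkcond /=; apply: eq_bigr => j _.
suff -> : agree_off p [set r] i j = (j \in codom f) by case: (_ \in _).
apply/agree_offP/codomP => [ij|[c ->] s]; last first.
  by rewrite inE fE => /negPf->.
exists (Ordinal (digit_lt j (p_gt0 r (ltn_ord r)))).
apply: (digit_inj p_gt0) => s; rewrite fE; case: eqP => [-> //|/eqP sr].
by rewrite -ij ?inE.
Qed.

Definition block_avg (R : realType) (n tau : nat) (p : nat -> nat)
    (S : {set 'I_tau}) : 'M[R]_n :=
  \matrix_(i, j) ((agree_off p S i j)%:R / (\prod_(s in S) p s)%:R).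

Lemma block_avg0 (R : realType) tau (p : nat -> nat) :
    (forall r, (r < tau)%N -> (0 < p r)%N) ->
  block_avg R (\prod_(r < tau) p r) p (set0 : {set 'I_tau}) = 1%:M.
Proof.
move=> p_gt0; apply/matrixP => i j.
by rewrite !mxE agree_off0 // big_set0 divr1.
Qed.

Lemma block_avgT (R : realType) n tau (p : nat -> nat) :
  block_avg R n p [set: 'I_tau] = const_mx (\prod_(r < tau) p r)%:R^-1.
Proof.
apply/matrixP => i j; rewrite !mxE.
under eq_bigl do rewrite inE.
suff -> : agree_off p [set: 'I_tau] i j by rewrite mul1r.
by apply/agree_offP => s; rewrite inE.
Qed.

Lemma mul_block_avg (R : realType) tau (p : nat -> nat) (S T : {set 'I_tau}) :
    (forall r, (r < tau)%N -> (0 < p r)%N) -> [disjoint S & T] ->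
  let n := (\prod_(r < tau) p r)%N in
  block_avg R n p S *m block_avg R n p T = block_avg R n p (S :|: T).
Proof.
move=> p_gt0 dST n; apply/matrixP => i j; rewrite !mxE.
rewrite -agree_off_setU // natr_sum mulr_suml; apply: eq_bigr => k _.
by rewrite !mxE (eq_bigl _ _ (fun s => in_setU s S T)) bigU //= !natrM invfM mulrACA.
Qed.

(** Absence of repetition makes each head [r] disjoint from the positions in the tail, so the order
    of [t] is irrelevant. *)
Lemma prod_block_avg (R : realType) tau (p : nat -> nat) (t : seq 'I_tau) :
    (forall r, (r < tau)%N -> (0 < p r)%N) -> uniq t ->
  let n := (\prod_(r < tau) p r)%N in
  \big[mulmx/1%:M]_(r <- t) block_avg R n p [set r] =
  block_avg R n p [set r in t].
Proof.
move=> p_gt0 + n; elim: t => [_|r t IHt /= /andP[rt /IHt IH]].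
  by rewrite big_nil set_nil block_avg0.
by rewrite big_cons IH mul_block_avg // ?set_cons // disjoints1 inE.
Qed.

(** If [i] and [j] differ in digit [r], then [i != j] and only the other digits decide. If they
    share it, agreement off [r] amounts to [i = j], the diagonal case. *)
Lemma hypercuboidE (R : realType) tau (p : nat -> nat) (l : nat) (r : 'I_tau) :
    (forall s, (s < tau)%N -> (0 < p s)%N) -> val r = (l %% tau)%N ->
  let n := (\prod_(s < tau) p s)%N in
  hypercuboid R n tau p l = block_avg R n p [set r].
Proof.
move=> p_gt0 rE n; apply/matrixP => i j; rewrite !mxE -rE big_set1.
have -> : [forall s : 'I_tau, (val s != val r) ==> (digit p i s == digit p j s)]
          = agree_off p [set r] i j.
  by apply: eq_forallb => s; rewrite inE.
have [eq_r|ne_r] /= := eqVneq (digit p i r) (digit p j r); last first.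
  case: (boolP (agree_off _ _ _ _)) => [_|/agree_offP nij]; first by rewrite mul1r.
  by rewrite mul0r; case: eqP => // eq_ij; case: nij; rewrite eq_ij.
suff -> : agree_off p [set r] i j = (i == j).
  by case: (i == j); rewrite ?mul1r ?mul0r.
apply/agree_offP/eqP => [ij|-> //]; apply: (digit_inj p_gt0) => s.
by have [->|sr] := eqVneq s r; last by rewrite ij ?inE.
Qed.

Lemma block_avg_sym (R : realType) n tau (p : nat -> nat) (S : {set 'I_tau}) :
  (block_avg R n p S)^T = block_avg R n p S.
Proof. by apply/matrixP => i j; rewrite !mxE agree_off_sym. Qed.

Lemma block_avg1_stochastic (R : realType) tau (p : nat -> nat) (r : 'I_tau) :
    (forall s, (s < tau)%N -> (0 < p s)%N) ->
  doubly_stochastic (block_avg R (\prod_(s < tau) p s) p [set r]).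
Proof.
move=> p_gt0; set B := block_avg _ _ _ _.
have row_sum i : \sum_j B i j = 1.
  under eq_bigr do rewrite mxE big_set1.
  rewrite -mulr_suml -natr_sum sum_agree_off1 // divff //.
  by rewrite pnatr_eq0 -lt0n p_gt0.
split=> [i j||j]; first by rewrite mxE divr_ge0.
- exact: row_sum.
(* By symmetry a column sum is a row sum. *)
rewrite -(row_sum j); apply: eq_bigr => i _.
by rewrite -{1}[B]block_avg_sym mxE.
Qed.

Theorem proposition3p3 (R : realType) (n tau : nat) (p : nat -> nat)
    (hn : (2 <= n)%N)
    (hp : forall r : nat, (r < tau)%N -> prime (p r))
    (hnp : n = (\prod_(r < tau) p r)%N) :
  (forall l : nat,
     (hypercuboid R n tau p l)^T = hypercuboid R n tau p l /\
     doubly_stochastic (hypercuboid R n tau p l)) /\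
  (forall l : 'I_tau -> nat,
     (forall k : nat, (exists i : 'I_tau, (l i %% tau)%N = k) <-> (k < tau)%N) ->
     finite_time_consensus (fun i : 'I_tau => hypercuboid R n tau p (l i))).
Proof.
have tau_gt0 : (0 < tau)%N.
  (* With [tau = 0] the empty product would give [n = 1]. *)
  by rewrite lt0n; apply: contraTneq hn => tau0; rewrite hnp tau0 big_ord0.
have p_gt0 r : (r < tau)%N -> (0 < p r)%N by move/hp/prime_gt0.
pose pos l : 'I_tau := Ordinal (ltn_pmod l tau_gt0).
subst n.
have WE l := hypercuboidE R (r := pos l) p_gt0 erefl.
have W_stoch l : doubly_stochastic (hypercuboid R (\prod_(r < tau) p r) tau p l).
  by rewrite WE; apply: block_avg1_stochastic.
split=> [l|l l_surj]; first by split=> //; rewrite WE block_avg_sym.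
split=> //.
have f_codom (k : 'I_tau) : exists i, k = pos (l (rev_ord i)).
  have [_ /(_ (ltn_ord k))[i ik]] := l_surj k.
  by exists (rev_ord i); apply: val_inj; rewrite rev_ordK /= ik.
(* The positions treated by the factors, listed from left to right in the product, hence the
   reversal. *)
pose t := [seq pos (l (rev_ord i)) | i <- index_enum 'I_tau].
have mem_t k : k \in t.
  by have [i ->] := f_codom k; apply: map_f; rewrite mem_index_enum.
have uniq_t : uniq t.
  (* Pigeonhole: a list of length [tau] that contains all [tau] positions cannot repeat one. *)
  apply: (leq_size_uniq (index_enum_uniq 'I_tau)) => [k _|]; first exact: mem_t.
  by rewrite size_map.
rewrite (eq_bigr _ (fun i _ => WE (l (rev_ord i)))).
rewrite -(big_map (fun i => pos (l (rev_ord i))) xpredT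
  (fun r => block_avg R _ p [set r])) prod_block_avg //.
have -> : [set r in t] = setT by apply/setP => r; rewrite !inE mem_t.
rewrite block_avgT; apply/matrixP => i j.
by rewrite !mxE big_ord1 !mxE !mulr1.
Qed.
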